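(* Let $\mathcal{C}$ be an $(n,m,q)$ wide-sense $2$-frameproof code with $n$ odd and $n\geq 7$. Then $$m\le\begin{cases}\displaystyle\binom{n}{\frac{n-1}{2}}-\frac{n^2-9}{8}-\left\lfloor\frac{(n-5)^2}{64}\right\rfloor, & \text{if } n\equiv 1\pmod 4,\\[2ex] \displaystyle\binom{n}{\frac{n-1}{2}}-\frac{(n+1)^2-8}{8}-\left\lfloor\frac{(n-3)^2}{64}\right\rfloor, & \text{if } n\equiv 3\pmod 4.\end{cases}$$
   Context: Let $Q$ be a finite alphabet of size $q$. A code $\mathcal{C}\subseteq Q^n$ with $|\mathcal{C}|=m$ is called an $(n,m,q)$ code. For a (nonempty) finite set $X=\{x^1,\ldots,x^t\}\subseteq Q^n$, where $x^j_i$ is the $i$-th component of $x^j$, let $U(X)=\{i\in\{1,\ldots,n\}: x^1_i=\cdots=x^t_i\}$ be the set of undetectable positions for $X$, and define the wide-sense descendant set $$\operatorname{wdesc}(X)=\{y\in Q^n: y_i=x^1_i \text{ for all } i\in U(X)\}.$$ A code $\mathcal{C}\subseteq Q^n$ is a wide-sense $t$-frameproof code ($t$-wFP code) if $\operatorname{wdesc}(X)\cap\mathcal{C}=X$ for all (nonempty) $X\subseteq\mathcal{C}$ with $|X|\le t$. *)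

(* Defs.v *)
From mathcomp Require Import all_boot all_order all_algebra.

Set Implicit Arguments.
Unset Strict Implicit.
Unset Printing Implicit Defensive.

Section WideSenseFrameproof.

Variables (Q : finType) (n : nat).

Definition word := {ffun 'I_n -> Q}.

Implicit Types (X C : {set word}).

Definition undetectable X : {set 'I_n} :=
  [set i | [forall x in X, forall y in X, x i == y i]].

(* All x in X agree on undetectable X, so comparing y with every x in X is the
   same as comparing it with a chosen first element of X (X nonempty). *)
Definition wdesc X : {set word} :=
  [set y : word | [forall i in undetectable X, forall x in X, y i == x i]].

Definition wide_frameproof (t : nat) C : Prop :=
  forall X, X != set0 -> X \subset C -> #|X| <= t -> wdesc X :&: C = X.

End WideSenseFrameproof.

Definition is_code (Q : finType) (n m q : nat) (C : {set word Q n}) : Prop :=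
  #|Q| = q /\ #|C| = m.

(* Main.v *)
Require Import Defs.
From mathcomp Require Import all_boot all_order all_algebra.
From mathcomp Require Import zify lra.
Import Order.TTheory GRing.Theory Num.Theory.

Set Implicit Arguments.
Unset Strict Implicit.
Unset Printing Implicit Defensive.

(** Write n = 2k+1 and N = 'C(n, k). For a codeword x, look at the sets
    agree x y of positions where x and another codeword y coincide. Applied to
    all triples, the frameproof condition says that these m - 1 sets are
    distinct, form an antichain, and that no two of them cover all positions
    ([agree_sub_eq], [agree_not_cover]). There are two cases.

    - Some two codewords agree in at most one position i. All other sets of one
      of the families then live in the n - 1 positions different from i, and
      Sperner's theorem gives m <= 'C(2k, k) + 2, about half of N
      ([card_le_of_small_agreement]).

    - Any two codewords agree in at least two positions. If agree x y and
      agree x z were disjoint k-sets, then y and z could only agree in the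
      single position outside both. Hence the k-sets of the family of x,
      together with the complements of its (k+1)-sets, pairwise intersect, so
      there are p <= N / 2 of them ([middle_levels_le_half]). The o
      other sets have sizes whose binomial coefficient is at most
      'C(n, k-1) = N k / (k+2), so the Lubell-Yamamoto-Meshalkin inequality
      reads k p + (k+2) o <= k N.

    Both cases imply (k+2)(m-1) <= (k+1) N ([wfp_size_bound]), a saving of about
    N / (k+2). As N grows exponentially, this beats the quadratic correction in
    the theorem as soon as k >= 4 ([bin_middle_lower_bound]). For k = 3 the
    inequality allows m = 29, and the integrality of p <= 35 / 2 is what
    brings m down to 28. *)

(** * Binomial coefficients *)

Lemma leq_bin_incr n a b : a <= b -> b <= n./2 -> 'C(n, a) <= 'C(n, b).
Proof.
move=> + hb; elim: b hb => [|b IH] hb; first by rewrite leqn0 => /eqP->.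
rewrite leq_eqVlt => /predU1P[->//|]; rewrite ltnS => lab.
apply: leq_trans (IH (ltnW hb) lab) _.
rewrite -(leq_pmul2l (ltn0Sn b)) mul_bin_left leq_pmul2r ?bin_gt0; lia.
Qed.

Lemma leq_bin_central k a : 'C(k.*2, a) <= 'C(k.*2, k).
Proof.
have [le_ak|lt_ka] := leqP a k; first by apply: leq_bin_incr; lia.
have [le_a|lt_a] := leqP a k.*2; last by rewrite bin_small.
by rewrite -bin_sub //; apply: leq_bin_incr; lia.
Qed.

Lemma leq_bin_off_middle k a : 0 < k -> a != k -> a != k.+1 ->
  'C(k.*2.+1, a) <= 'C(k.*2.+1, k.-1).
Proof.
move=> k0 neq1 neq2.
have [le_ak|lt_ka] := leqP a k; first by apply: leq_bin_incr; lia.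
have [le_a|lt_a] := leqP a k.*2.+1; last by rewrite bin_small.
by rewrite -bin_sub //; apply: leq_bin_incr; lia.
Qed.

Lemma bin_below_middle k : 0 < k ->
  k.+2 * 'C(k.*2.+1, k.-1) = k * 'C(k.*2.+1, k).
Proof.
case: k => // k _; rewrite mul_bin_left /=; congr (_ * _); lia.
Qed.

Lemma bin_middle_even k : k.*2.+1 * 'C(k.*2, k) = k.+1 * 'C(k.*2.+1, k).
Proof. rewrite (mul_bin_down k.*2.+1 k); congr (_ * _); lia. Qed.

(** The true ratio tends to 4; the factor 2 already outgrows a cubic
    polynomial. *)
Lemma bin_middle_double k : 2 * 'C(k.*2.+1, k) <= 'C(k.+1.*2.+1, k.+1).
Proof.
have e : 'C(k.*2.+1, k.+1) = 'C(k.*2.+1, k).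
  by rewrite -bin_sub; [congr binomial|]; lia.
rewrite doubleS binS binS e; lia.
Qed.

(** The polynomial is k+2 times 16 (c + 1), where c = (k^2 + 2k - 1) / 2 +
    (k - 1)^2 / 16 bounds the amount subtracted from 'C(n, k) in both residue
    classes of n = 2k+1; it is that amount, without the floor, for k odd. *)
Lemma bin_middle_lower_bound k : 4 <= k ->
  k.+2 * (9 * k ^ 2 + 14 * k + 9) <= 16 * 'C(k.*2.+1, k).
Proof.
elim: k => // k IH; rewrite leq_eqVlt => /predU1P[<-|hk].
  by have -> : 'C(4.*2.+1, 4) = 126 by [].
have {IH} := IH hk; have := bin_middle_double k.
move: ('C(_, _)) ('C(_, _)) => a b; nia.
Qed.

(** * Antichains and intersecting families of finite sets *)

Section SetFamilies.
Variable T : finType.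
Implicit Types (A B S : {set T}) (F G I : {set {set T}}).

Definition antichain F :=
  forall A B, A \in F -> B \in F -> A \subset B -> A = B.

Lemma antichain_sub F G : G \subset F -> antichain F -> antichain G.
Proof. by move=> /subsetP sGF aF A B /sGF FA /sGF; apply: aF. Qed.

Section LYM.
Local Open Scope ring_scope.

(** By induction on S. Unless F = {S}, every member misses a point of S. For
    each i in S the members avoiding i form an antichain in S minus i; summing
    the inequalities for all i counts A exactly #|S| - #|A| times, and
    (#|S| - #|A|) / 'C(#|S| - 1, #|A|) = #|S| / 'C(#|S|, #|A|). *)
Lemma lubell_yamamoto_meshalkin S F : antichain F ->
  (forall A, A \in F -> A \subset S) ->
  \sum_(A in F) ('C(#|S|, #|A|)%:R^-1 : rat) <= 1.
Proof.
have [s] := ubnP #|S|; elim: s S F => // s IH S F leS aF sFS.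
have [FS|nFS] := boolP (S \in F).
  have -> : F = [set S].
    apply/setP=> A; rewrite inE; apply/idP/eqP=> [FA|->//].
    by apply: aF => //; apply: sFS.
  by rewrite big_set1 binn invr1.
have ltF A : A \in F -> (#|A| < #|S|)%N.
  move=> FA; apply: proper_card; rewrite properEneq sFS // andbT.
  by apply: contra nFS => /eqP <-.
have [S0|S_gt0] := posnP #|S|.
  by rewrite big1 // => A /ltF; rewrite S0.
have deletion i : i \in S ->
    \sum_(A in F | i \notin A) ('C(#|S|.-1, #|A|)%:R^-1 : rat) <= 1.
  move=> Si; have cardSi : #|S :\ i| = #|S|.-1.
    by rewrite (cardsD1 i S) Si.
  have := IH (S :\ i) [set A in F | i \notin A].
  rewrite cardSi (eq_bigl _ _ (in_set _)); apply.
  - by rewrite prednK.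
  - by apply: antichain_sub aF; apply/subsetP=> A /setIdP[].
  - by move=> A /setIdP[FA nAi]; rewrite subsetD1 sFS.
have S_pos : 0 < (#|S|%:R : rat) by rewrite ltr0n.
rewrite -(ler_pM2l S_pos) mulr1 mulr_sumr.
have -> : \sum_(A in F) #|S|%:R * 'C(#|S|, #|A|)%:R^-1 =
    \sum_(i in S) \sum_(A in F | i \notin A) ('C(#|S|.-1, #|A|)%:R^-1 : rat).
  rewrite (exchange_big_dep (mem F)) /=; last by move=> i A _ /andP[].
  apply: eq_bigr => A FA.
  rewrite (eq_bigl (mem (S :\: A))); last first.
    by move=> i; rewrite !inE FA andbC.
  rewrite sumr_const cardsD (setIidPr (sFS A FA)).
  have ltA := ltF A FA; have leA := ltnW ltA.
  have C1 : ('C(#|S|, #|A|)%:R : rat) != 0.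
    by rewrite pnatr_eq0 -lt0n bin_gt0.
  have C2 : ('C(#|S|.-1, #|A|)%:R : rat) != 0.
    by rewrite pnatr_eq0 -lt0n bin_gt0; lia.
  have /(congr1 (fun p => p%:R : rat)) := mul_bin_down #|S| #|A|.
  rewrite !natrM => E; apply: (mulIf C1); apply: (mulIf C2).
  rewrite divfK // E -[_^-1 *+ _]mulr_natl.
  by rewrite mulrAC divfK // mulrC.
rewrite -[leRHS]mulr1 mulr_natl -sumr_const.
exact: ler_sum.
Qed.
End LYM.

(** The LYM inequality for integral weights: w = 1 gives Sperner's theorem, and
    a heavier weight on the sparser levels gives a refinement of it. *)
Lemma antichain_weight_le S F (w : {set T} -> nat) W : antichain F ->
  (forall A, A \in F -> A \subset S) ->
  (forall A, A \in F -> w A * 'C(#|S|, #|A|) <= W) ->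
  \sum_(A in F) w A <= W.
Proof.
move=> aF sFS wF; rewrite -(ler_nat rat) natr_sum.
have LYM := lubell_yamamoto_meshalkin aF sFS.
apply: le_trans (_ : W%:R * (\sum_(A in F) ('C(#|S|, #|A|)%:R^-1 : rat)) <= _)%R.
  rewrite mulr_sumr; apply: ler_sum => A FA.
  have C_gt0 : (0 < 'C(#|S|, #|A|)%:R :> rat)%R.
    by rewrite ltr0n bin_gt0 subset_leq_card ?sFS.
  by rewrite ler_pdivlMr // -natrM ler_nat wF.
by rewrite -[leRHS]mulr1 ler_wpM2l.
Qed.

Lemma card_disjoint_subsets A k :
  #|[set B : {set T} | [disjoint A & B] & #|B| == k]| = 'C(#|~: A|, k).
Proof.
rewrite -cards_draws; apply: eq_card => B.
by rewrite !inE disjoint_sym disjoints_subset.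
Qed.

(** The disjointness graph on the k-subsets of a (2k+1)-set is regular of degree
    k+1, and I is independent in it: double counting the edges that leave I
    shows that I is at most as large as its complement. This is weaker than the
    Erdos-Ko-Rado bound. *)
Lemma intersecting_le_half k I : #|T| = k.*2.+1 ->
  (forall A, A \in I -> #|A| = k) ->
  (forall A B, A \in I -> B \in I -> ~~ [disjoint A & B]) ->
  2 * #|I| <= 'C(k.*2.+1, k).
Proof.
move=> cT kI capI.
pose J := [set B : {set T} | #|B| == k] :\: I.
have cardIJ : #|I| + #|J| = 'C(k.*2.+1, k).
  rewrite -cT -cardsT -cards_draws -[RHS](cardsID I).
  congr (_ + _); apply: eq_card => A; rewrite !inE subsetT //=.
  by case: (boolP (A \in I)) => [/kI->|_]; rewrite ?eqxx ?andbF.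
have degree A : #|A| = k ->
  \sum_(B : {set T} | [disjoint A & B] && (#|B| == k)) 1 = k.+1.
  move=> kA; rewrite sum1dep_card card_disjoint_subsets cardsCs setCK cT kA.
  have -> : k.*2.+1 - k = k.+1 by lia.
  by rewrite binSn.
suff : #|I| * k.+1 <= #|J| * k.+1 by rewrite leq_pmul2r //; lia.
have -> : #|I| * k.+1 = \sum_(A in I) \sum_(B in J | [disjoint A & B]) 1.
  rewrite -sum_nat_const; apply: eq_bigr => A IA; rewrite -(degree A (kI A IA)).
  apply: eq_bigl => B; rewrite !inE; case: (boolP (B \in I)) => IB /=.
    by rewrite (negbTE (capI A B IA IB)).
  by rewrite andbC.
rewrite (exchange_big_dep (mem J)) /=; last by move=> A B _ /andP[].
rewrite -sum_nat_const; apply: leq_sum => B JB.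
have kB : #|B| = k by move: JB; rewrite !inE => /andP[_ /eqP].
rewrite -(degree B kB) [leqLHS]big_mkcond [leqRHS]big_mkcond /=.
apply: leq_sum => A _; case: ifP => // /andP[IA /andP[_ dAB]].
by rewrite disjoint_sym dAB kI ?eqxx.
Qed.

End SetFamilies.

(** * Agreement sets of a wide-sense 2-frameproof code *)

Section AgreementSets.
Variables (Q : finType) (n : nat) (C : {set word Q n}).
Hypothesis C_wfp : wide_frameproof 2 C.
Implicit Types x y z : word Q n.

Definition agree x y : {set 'I_n} := [set i | x i == y i].

Definition agreement_family x : {set {set 'I_n}} := agree x @: (C :\ x).

(** Otherwise x would be a wide-sense descendant of y and z. All that follows
    uses the frameproof property only in this form. *)
Lemma wfp_separates x y z : x \in C -> y \in C -> z \in C ->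
  x != y -> x != z -> exists2 i, y i = z i & x i != y i.
Proof.
move=> Cx Cy Cz xy xz.
have [/existsP[i /andP[/eqP yz xyi]]|noi] :=
  boolP [exists i, (y i == z i) && (x i != y i)]; first by exists i.
have : x \in wdesc [set y; z] :&: C.
  rewrite !inE Cx andbT; apply/forall_inP=> i; rewrite inE => /forall_inP U.
  have yz : y i = z i.
    by apply/eqP; move/forall_inP: (U y (set21 _ _)); apply; apply: set22.
  move/existsPn: noi => /(_ i); rewrite yz eqxx /= negbK => /eqP xzi.
  by apply/forall_inP=> w /set2P[]->; rewrite xzi ?yz.
rewrite C_wfp; first by rewrite !inE (negbTE xy) (negbTE xz).
- by apply/set0Pn; exists y; apply: set21.
- by apply/subsetP=> w /set2P[]->.
- by rewrite cards2; case: (y != z).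
Qed.

(** Otherwise z would be a descendant of x and y. *)
Lemma agree_sub_eq x y z : x \in C -> y \in C :\ x -> z \in C :\ x ->
  agree x y \subset agree x z -> y = z.
Proof.
rewrite !inE => Cx /andP[yx Cy] /andP[zx Cz] /subsetP sub.
apply/eqP; apply: contraT => yz.
have zy : z != y by rewrite eq_sym.
have [i xy /negP[]] := wfp_separates Cz Cx Cy zx zy.
by have := sub i; rewrite !inE xy eqxx eq_sym; apply.
Qed.

(** A position separating x from both y and z lies in neither set. *)
Lemma agree_not_cover x y z : x \in C -> y \in C :\ x -> z \in C :\ x ->
  agree x y :|: agree x z != setT.
Proof.
rewrite !inE => Cx /andP[yx Cy] /andP[zx Cz].
have xy : x != y by rewrite eq_sym.
have xz : x != z by rewrite eq_sym.
have [i yz xyi] := wfp_separates Cx Cy Cz xy xz.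
by apply/eqP=> /setP/(_ i); rewrite !inE -yz orbb (negbTE xyi).
Qed.

Lemma agreement_family_antichain x : x \in C -> antichain (agreement_family x).
Proof.
move=> Cx A B /imsetP[y Cy ->] /imsetP[z Cz ->].
by move/(agree_sub_eq Cx Cy Cz)->.
Qed.

Lemma card_agreement_family x : x \in C -> #|C| = #|agreement_family x|.+1.
Proof.
move=> Cx; rewrite (cardsD1 x) Cx card_in_imset // => y z Cy Cz eq_a.
by apply: (agree_sub_eq Cx); rewrite // eq_a.
Qed.

End AgreementSets.

(** * The size bound in odd length *)

Section OddLength.
Variables (Q : finType) (k : nat) (C : {set word Q k.*2.+1}).
Hypothesis C_wfp : wide_frameproof 2 C.
Implicit Types x y z : word Q k.*2.+1.

(** By the antichain property, no other agreement set of x contains a position i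
    whose singleton contains agree x y, so Sperner's theorem applies in the 2k
    remaining positions. *)
Lemma card_le_of_small_agreement x y : x \in C -> y \in C :\ x ->
  #|agree x y| <= 1 -> #|C| <= 'C(k.*2, k).+2.
Proof.
move=> Cx Cy agree_le1; rewrite (card_agreement_family C_wfp Cx) ltnS.
set F := agreement_family C x.
have Fa : agree x y \in F by apply: imset_f.
have aF : antichain F by apply: agreement_family_antichain.
have [i sub_i] : exists i, agree x y \subset [set i].
  have [->|[i Ai]] := set_0Vmem (agree x y); first by exists ord0; apply: sub0set.
  exists i; have /card_le1P/(_ i Ai) E := agree_le1.
  by apply/subsetP=> j; rewrite E inE.
rewrite (cardsD1 (agree x y)) Fa ltnS -sum1_card.
have cardS : #|[set~ i]| = k.*2 by rewrite cardsC1 card_ord.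
apply: (@antichain_weight_le _ [set~ i]) => [|A|A _].
- by apply: antichain_sub aF; apply: subD1set.
- rewrite !inE => /andP[neqA FA]; rewrite subsetC sub1set inE.
  apply: contra neqA => Ai; rewrite eq_sym; apply/eqP/aF => //.
  by apply: subset_trans sub_i _; rewrite sub1set.
- by rewrite cardS mul1n leq_bin_central.
Qed.

(** Complementing the (k+1)-sets turns the two middle levels into one family of
    k-sets. It is intersecting for a different reason in each case: two
    disjoint k-sets agree x y and agree x z would leave at most one position
    where y and z agree; a k-set disjoint from the complement of a (k+1)-set
    would be contained in it, against the antichain property; two disjoint
    complements would come from two sets that cover everything. *)
Lemma middle_levels_le_half x : 0 < k -> x \in C ->
  (forall y z, y \in C -> z \in C :\ y -> 1 < #|agree y z|) ->
  2 * #|[set A in agreement_family C x | #|A| \in [:: k; k.+1]]|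
    <= 'C(k.*2.+1, k).
Proof.
move=> k_gt0 Cx large; set F := agreement_family C x; set M := [set A in F | _].
pose f (A : {set 'I_k.*2.+1}) := if #|A| == k then A else ~: A.
have aF : antichain F by apply: agreement_family_antichain.
have cover A B : A \in F -> B \in F -> A :|: B != setT.
  by move=> /imsetP[y Cy ->] /imsetP[z Cz ->]; apply: (agree_not_cover C_wfp Cx).
have levelM A : A \in M -> A \in F /\ (#|A| = k \/ #|A| = k.+1).
  by rewrite !inE => /andP[-> /orP[]/eqP->]; split; auto.
have Sk_neq : (k.+1 == k) = false by lia.
have f_card A : A \in M -> #|f A| = k.
  move=> /levelM[_ []] cA; rewrite /f cA ?eqxx // Sk_neq.
  by rewrite cardsCs setCK card_ord cA; lia.
have neqC A B : A \in F -> B \in F -> A <> ~: B.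
  move=> FA FB eqA; have := cover A B FA FB.
  by rewrite eqA setUC setUCr eqxx.
have f_inj : {in M &, injective f}.
  move=> A B /levelM[FA cA] /levelM[FB cB]; rewrite /f.
  case: ifP => _; case: ifP => _ //.
  - by move/(neqC _ _ FA FB).
  - by move/esym/(neqC _ _ FB FA).
  - exact: setC_inj.
rewrite -(card_in_imset f_inj); apply: intersecting_le_half.
- exact: card_ord.
- by move=> _ /imsetP[A MA ->]; apply: f_card.
have sub_disjoint A B : A \in F -> B \in F -> #|A| = k -> #|B| = k.+1 ->
    ~~ [disjoint A & ~: B].
  move=> FA FB cA cB; rewrite disjoints_subset setCK.
  by apply/negP=> /aF E; move: cB; rewrite -E // cA => /eqP; rewrite eq_sym Sk_neq.
move=> _ _ /imsetP[A MA ->] /imsetP[B MB ->].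
have [[FA cA] [FB cB]] := (levelM A MA, levelM B MB).
case: cA cB => cA [] cB; rewrite /f cA cB ?eqxx ?Sk_neq.
- apply/negP=> dAB; case/imsetP: FA => y /setD1P[_ Cy] eA.
  case/imsetP: FB => z /setD1P[_ Cz] eB.
  have zy : z != y.
    apply: contraTneq dAB => zy; rewrite eA eB zy -setI_eq0 setIid -eA.
    by rewrite -card_gt0 cA.
  have /large/(_ _) := Cy; move=> /(_ z); rewrite !inE zy Cz => /(_ isT).
  apply/negP; rewrite -leqNgt.
  have sub : agree y z \subset ~: (A :|: B).
    rewrite subsetC; apply/subsetP=> i; rewrite inE => ABi; rewrite inE.
    apply/negP; rewrite inE => /eqP yz; move: dAB; rewrite disjoint_subset.
    by move=> /subsetP/(_ i); move: ABi; rewrite eA eB !inE -yz orbb => -> /(_ isT).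
  apply: leq_trans (subset_leq_card sub) _.
  rewrite cardsCs setCK card_ord cardsU disjoint_setI0 // cards0 cA cB; lia.
- exact: sub_disjoint.
- by rewrite disjoint_sym sub_disjoint.
- rewrite disjoints_subset setCK; apply: contra (cover A B FA FB) => sub.
  by rewrite -subTset -(setUCr A) setUS // -setCS setCK.
Qed.

(** With p sets of size k or k+1 and o others, the case of large agreements combines
    2 p <= N with k p + (k+2) o <= k N, where N = 'C(2k+1, k). The bound for
    k = 3 is one better than what the first inequality gives. *)
Lemma wfp_size_bound : 2 < k ->
  (k.+2 * #|C|.-1 <= k.+1 * 'C(k.*2.+1, k)) /\ (k = 3 -> #|C| <= 28).
Proof.
move=> k_gt2; have [->|[x Cx]] := set_0Vmem C; first by rewrite cards0 muln0.
have [small|large] := boolP [exists y in C, exists z in C :\ y, #|agree y z| <= 1].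
  have [y Cy /exists_inP[z Cz yz1]] := exists_inP small.
  have le_c := card_le_of_small_agreement Cy Cz yz1.
  have le_M : k.*2 <= 'C(k.*2, k) by rewrite -[leqLHS]bin1 leq_bin_central.
  have M20 : k = 3 -> 'C(k.*2, k) = 20 by move=> ->.
  move: (bin_middle_even k) le_c le_M M20.
  move: #|C| 'C(k.*2, k) 'C(_, _) => c M N eMN le_c le_M M20.
  by split=> [|/M20]; [nia | lia].
have {}large y z : y \in C -> z \in C :\ y -> 1 < #|agree y z|.
  move=> Cy Cz; rewrite ltnNge; apply: contra large => yz1.
  by apply/exists_inP; exists y => //; apply/exists_inP; exists z.
have k_gt0 : 0 < k by lia.
have half := middle_levels_le_half k_gt0 Cx large.
rewrite (card_agreement_family C_wfp Cx).
set F := agreement_family C x in half *.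
pose mid := [pred A : {set 'I_k.*2.+1} | #|A| \in [:: k; k.+1]].
(* The weight is W / 'C(n, #|A|), with W = k N, on levels k-1, k, k+1 and k+2,
   and smaller than that on the rest. *)
have weight : \sum_(A in F) (if mid A then k else k.+2) <= k * 'C(k.*2.+1, k).
  apply: (@antichain_weight_le _ setT) => [|A _|A _].
  - exact: agreement_family_antichain.
  - exact: subsetT.
  rewrite cardsT card_ord /= !inE; case: eqP => [->//|/eqP nk].
  case: eqP => [->|/eqP nk1] /=.
    by rewrite -[X in _ * X <= _]bin_sub ?subSS -?addnn ?addnK //; lia.
  by rewrite -bin_below_middle // leq_mul2l leq_bin_off_middle ?orbT.
have sumE : \sum_(A in F) (if mid A then k else k.+2) +
    2 * #|[set A in F | mid A]| = k.+2 * #|F|.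
  rewrite -sum1dep_card big_mkcondr /= big_distrr -big_split /= mulnC.
  rewrite -sum_nat_const; apply: eq_bigr => A _; case: ifP => _; lia.
move: weight half sumE; rewrite /=.
move: (\sum_(A in F) _) #|[set A in F | _]| #|F| => w p f weight half sumE.
split; first nia.
move=> k3; move: weight half sumE; rewrite k3.
have -> : 'C(3.*2.+1, 3) = 35 by []; lia.
Qed.

End OddLength.

Local Open Scope ring_scope.

Theorem theorem3p5 (Q : finType) (n m q : nat) (C : {set word Q n})
    (hcode : is_code m q C) (hwFP : wide_frameproof 2 C)
    (hodd : odd n) (hn : (7 <= n)%N) :
  ((n %% 4 = 1)%N ->
     m%:R <= 'C(n, (n - 1) %/ 2)%:R - (n%:R ^+ 2 - 9) / 8
             - (Num.floor ((n%:R - 5) ^+ 2 / 64 : rat))%:~R :> rat) /\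
  ((n %% 4 = 3)%N ->
     m%:R <= 'C(n, (n - 1) %/ 2)%:R - ((n%:R + 1) ^+ 2 - 8) / 8
             - (Num.floor ((n%:R - 3) ^+ 2 / 64 : rat))%:~R :> rat).
Proof.
have [k nE] : exists k, n = k.*2.+1 by exists n./2; lia.
subst n; case: hcode => _ cardC.
have -> : ((k.*2.+1 - 1) %/ 2 = k)%N by lia.
have [|bound bound3] := wfp_size_bound hwFP; first by lia.
move: bound bound3; rewrite cardC => bound bound3.
have nE : k.*2.+1%:R = 2 * k%:R + 1 :> rat.
  by rewrite -addn1 natrD -mul2n natrM.
(* For n = 7 the floor matters: it rounds 1/4 down to 0, and the bound is
   the integer 28. *)
have [k3|k_ge4] : k = 3 \/ (4 <= k)%N by lia.
  have m28 : m%:R <= 28%:R :> rat by rewrite ler_nat bound3.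
  have -> : 'C(k.*2.+1, k) = 35 by rewrite k3.
  split=> [|_]; first by lia.
  rewrite nE k3.
  have -> : Num.floor ((2 * 3%:R + 1 - 3) ^+ 2 / 64 : rat) = 0.
    by apply: floor_def; apply/andP; split; lra.
  lra.
have {bound} : (16 * m + 9 * k ^ 2 + 14 * k <= 16 * 'C(k.*2.+1, k) + 7)%N.
  have := bin_middle_lower_bound k_ge4.
  move: ('C(_, _)) bound => N bound Nlarge.
  have step : (k.+2 * m <= k.+2 * m.-1 + k.+2)%N by case: (m) => [|m'] /=; lia.
  by rewrite -(leq_pmul2l (ltn0Sn k.+1)); move: (k.+2 * m.-1)%N step bound; lia.
rewrite -(ler_nat rat) !natrD !natrM => bound.
have k_ge4R : 4%:R <= k%:R :> rat by rewrite ler_nat.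
split=> _.
  have := floor_le ((k.*2.+1%:R - 5) ^+ 2 / 64 : rat); rewrite nE; nra.
have := floor_le ((k.*2.+1%:R - 3) ^+ 2 / 64 : rat); rewrite nE; nra.
Qed.
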